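(* Let $M$ be a mean-field game (MFG) model on a finite undirected network $\Gamma$. Suppose that for every edge $e_k=(v_r,v_i)$ of $\Gamma$ the travel costs are reversible ($c_k^i(j)=c_k^r(j)$ for all $j\in\mathbb R$), even ($c_k^i(-j)=c_k^i(j)$ for all $j\in\mathbb R$), increasing for positive current, and satisfy $c_k^i(j)+c_k^r(-j)>0$ for all $j$. Then in the MFG the current is uniquely defined in each edge: if $(\boldsymbol u,\boldsymbol\jmath)$ and $(\hat{\boldsymbol u},\hat{\boldsymbol\jmath})$ both solve $M$, then $j_k=\hat\jmath_k$ for every edge $e_k$.
   Context: **MFG model $M$.** $\Gamma=(E,V)$ is a finite undirected network; an edge $e_k$ with endpoints $v_r,v_i$ is written $e_k=(v_r,v_i)$. Some vertices are entrance vertices and some others (disjoint from these) are exit vertices; all of them have incidence $1$. A current $\iota>0$ is prescribed at each entrance vertex; the exit cost is zero at each exit vertex. Each edge $e_k=(v_r,v_i)$ is identified with $[0,1]$ ($v_r$ with $0$, $v_i$ with $1$) and carries a Hamiltonian $H_k(x,p,m)$, smooth and convex in $p$, with Lagrangian $L_k(x,v,m)=\sup_p\{-pv-H_k(x,p,m)\}$. For $j\in\mathbb R$, $m^k(x,j)$ denotes the density determined by the edge MFG system $H_k(x,u_x,m)=0$, $-mD_pH_k(x,u_x,m)=j$. The travel costs are $c_k^i(j)=\min\int_0^T L_k(x,\dot x,m^k(x,j))\,dt$ over all $T$ and Lipschitz trajectories with $x(0)=0$, $x(T)=1$ (moving from $v_r$ to $v_i$), and $c_k^r(j)$, the same with $x(0)=1$,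 $x(T)=0$ (moving from $v_i$ to $v_r$). Moving from $e_k$ to $e_l$ through a common vertex $v_i$ costs a constant $\psi_{kl}^i$, with $\psi^i_{kl}\le\psi^i_{kp}+\psi^i_{pl}$ at vertices with more than two incident edges. Unknowns of $M$: for each edge $e_k=(v_r,v_i)$, currents $j_k^i,j_k^r\ge0$ (towards $v_i$, respectively $v_r$), with $j_k=j_k^i-j_k^r$; transition currents $j_{kl}^i\ge 0$ from $e_k$ to $e_l$ ($k\ne l$) through a common vertex $v_i$; and the values $u_k^i$ of the value function for each pair (edge $e_k$, endpoint $v_i$ of $e_k$). A solution $(\boldsymbol u,\boldsymbol\jmath)$ satisfies: (1) $j_k^ij_k^r=0$ and $j_{kl}^ij_{lk}^i=0$; (2) $u_k^i\le u_l^i+\psi_{kl}^i$ and $j_{kl}^i\,(u_k^i-u_l^i-\psi_{kl}^i)=0$ for all $i,k,l$; (3) on each edge $e_k=(v_r,v_i)$: $u_k^r\le c_k^i(j_k)+u_k^i$, $u_k^i\le c_k^r(j_k)+u_k^r$, $j_k^i(u_k^r-u_k^i-c_k^i(j_k))=0$, $j_k^r(u_k^i-u_k^r-c_k^r(j_k))=0$; (4) for every edge $e_k=(v_r,v_i)$ and endpoint $v_i$ that is neither an entrance nor an exit, with $\mathcal E$ the set of edges other than $e_k$ incident at $v_i$: $\sum_{e_l\in\mathcal E}j_{kl}^i=j_k^i$ and $\sum_{e_l\in\mathcal E}j_{lk}^i=j_k^r$; (5) if $e_k=(v_r,v_i)$ with $v_r$ an entrance vertex with entry current $\iota$: $j_k^i=\iota$,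 $j_k^r=0$; (6) if $e_l=(v_i,v_s)$ with $v_s$ an exit vertex: $j_l^i=0$, and $u_l^s\le0$ with equality if $j_l^s>0$. The positivity hypothesis $c_k^i(j)+c_k^r(-j)>0$ is the condition that the costs on the two opposite directed edges associated with $e_k$ in the corresponding Wardrop model, $c_k^i(j_k^i-j_k^r)$ and $c_k^r(j_k^r-j_k^i)$, have positive sum.
   Formalization: ''Increasing for positive current'' is taken as strictly increasing on [0,∞), zero current included; if the cost at zero current may exceed the costs at small positive current, uniqueness fails on two parallel routes. For costs continuous at zero this adds nothing. *)

(* Defs.v *)
From HB Require Import structures.
From mathcomp Require Import all_boot all_order all_algebra.
From mathcomp Require Import all_classical all_reals all_analysis.
From mathcomp Require Import measurable_realfun.
Set Implicit Arguments.
Unset Strict Implicit.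
Unset Printing Implicit Defensive.
Import Order.TTheory GRing.Theory Num.Theory.
Import numFieldNormedType.Exports.

Local Open Scope ring_scope.
Local Open Scope classical_set_scope.

(* A finite undirected network.  Naming the endpoints of an edge "source" and
   "target" does not direct the edge: it only fixes the identification of the
   edge with [0, 1] (source at 0, target at 1) and the sign of its current.
   Parallel edges are allowed. *)
Record network := Network {
  vertex : finType;
  edge : finType;
  source : edge -> vertex;
  target : edge -> vertex;
  source_neq_target : forall k, source k != target k
}.

Definition endpoint (G : network) (k : edge G) (v : vertex G) : bool :=
  (v == source k) || (v == target k).

Definition incident (G : network) (v : vertex G) : {set edge G} :=
  [set k | endpoint k v]%SET.

Definition opposite (G : network) (k : edge G) (v : vertex G) : vertex G :=
  if v == source k then target k else source k.

Record mfg_data (R : realType) (G : network) := MfgData {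
  entrance : {set vertex G};
  exits : {set vertex G};
  entry_current : vertex G -> R;
  (* H_k(x, p, m) *)
  hamiltonian : edge G -> R -> R -> R -> R;
  (* m^k(x, j) *)
  edge_density : edge G -> R -> R -> R;
  (* psi_{kl}^i is [switch_cost i k l] *)
  switch_cost : vertex G -> edge G -> edge G -> R
}.

(* L_k(x, v, m); the supremum may be +oo, e.g. if H_k grows linearly in p. *)
Definition lagrangian (R : realType) (G : network) (M : mfg_data R G)
    (k : edge G) (x v m : R) : \bar R :=
  ereal_sup [set (- p * v - hamiltonian M k x p m)%:E | p in [set: R]].

(* The density [m] solves the edge MFG system
     H_k(x, u_x, m) = 0,   - m D_p H_k(x, u_x, m) = j   on [0, 1].
   A classical solution u on the closed interval extends differentiably to the
   real line, so that two-sided derivatives at 0 and 1 lose no generality. *)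
Definition edge_system (R : realType) (G : network) (M : mfg_data R G)
    (k : edge G) (j : R) (m : R -> R) : Prop :=
  exists u : R -> R, forall x : R, 0 <= x <= 1 ->
    [/\ derivable u x 1,
        0 <= m x,
        hamiltonian M k x (derive1 u x) (m x) = 0 &
        - m x * derive1 (hamiltonian M k x ^~ (m x)) (derive1 u x) = j].

Definition edge_coord (R : realType) (G : network) (k : edge G)
    (v : vertex G) : R := if v == target k then 1 else 0.

Definition running_cost (R : realType) (G : network) (M : mfg_data R G)
    (k : edge G) (j : R) (x : R -> R) (t : R) : \bar R :=
  lagrangian M k (x t) (derive1 x t) (edge_density M k (x t) j).

(* The last two conditions say that the integral of the running cost is
   meaningful in (-oo, +oo]; the library's integral is total, and is not
   informative without them.  The derivative of a Lipschitz x exists almost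
   everywhere, so the value of [derive1] elsewhere is irrelevant. *)
Definition admissible (R : realType) (G : network) (M : mfg_data R G)
    (k : edge G) (v : vertex G) (j T : R) (x : R -> R) : Prop :=
  [/\ 0 <= T,
      [lipschitz x t | t in `[0, T]],
      (forall t : R, 0 <= t <= T -> 0 <= x t <= 1),
      x 0 = edge_coord R k (opposite k v) /\ x T = edge_coord R k v &
      measurable_fun `[0, T] (running_cost M k j x) /\
      (\int[@lebesgue_measure R]_(t in `[0%R, T])
         (running_cost M k j x)^\- t < +oo)%E].

(* Costs of the trajectories that cross e_k and arrive at its endpoint v. *)
Definition trajectory_costs (R : realType) (G : network) (M : mfg_data R G)
    (k : edge G) (v : vertex G) (j : R) : set (\bar R) :=
  [set c | exists T x, admissible M k v j T x /\
     c = (\int[@lebesgue_measure R]_(t in `[0%R, T]) running_cost M k j x t)%E].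

(* c_k^i(j) is [travel_cost M k i j]: the upper index is the vertex of arrival.
   [mfg_model] requires the infimum to be a real number and a minimum. *)
Definition travel_cost (R : realType) (G : network) (M : mfg_data R G)
    (k : edge G) (v : vertex G) (j : R) : R :=
  fine (ereal_inf (trajectory_costs M k v j)).

Record mfg_model (R : realType) (G : network) (M : mfg_data R G) : Prop := {
  entrance_exit_disjoint : [disjoint entrance M & exits M]%B;
  entrance_incidence : forall v, v \in entrance M -> #|incident v| = 1%N;
  exit_incidence : forall v, v \in exits M -> #|incident v| = 1%N;
  entry_current_gt0 : forall v, v \in entrance M -> 0 < entry_current M v;
  hamiltonian_smooth : forall k (x m : R), 0 <= x <= 1 -> 0 <= m ->
    forall n p, derivable (derive1n n (hamiltonian M k x ^~ m)) p 1;
  hamiltonian_convex : forall k (x m : R), 0 <= x <= 1 -> 0 <= m ->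
    convex_function [set: R^o] (fun p : R^o => hamiltonian M k x p m);
  edge_density_solves : forall k j,
    edge_system M k j (edge_density M k ^~ j);
  travel_cost_min : forall k v j, endpoint k v ->
    exists c : R, trajectory_costs M k v j c%:E /\
                  lbound (trajectory_costs M k v j) c%:E;
  switch_cost_triangle : forall i k l p, (2 < #|incident i|)%N ->
    k \in incident i -> l \in incident i -> p \in incident i ->
    k != l -> k != p -> p != l ->
    switch_cost M i k l <= switch_cost M i k p + switch_cost M i p l
}.

(* Only the values of [flow k v] and [value k v] with v an endpoint of k, and
   those of [transition i k l] with k, l distinct and incident at i, are
   meaningful. *)
Record mfg_unknowns (R : realType) (G : network) := MfgUnknowns {
  (* j_k^i, the current in e_k towards v_i *)
  flow : edge G -> vertex G -> R;
  (* j_{kl}^i is [transition i k l] *)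
  transition : vertex G -> edge G -> edge G -> R;
  (* u_k^i *)
  value : edge G -> vertex G -> R
}.

(* j_k = j_k^i - j_k^r, for e_k = (v_r, v_i) *)
Definition current (R : realType) (G : network) (s : mfg_unknowns R G)
    (k : edge G) : R := flow s k (target k) - flow s k (source k).

Record mfg_solution (R : realType) (G : network) (M : mfg_data R G)
    (s : mfg_unknowns R G) : Prop := {
  flow_ge0 : forall k v, endpoint k v -> 0 <= flow s k v;
  transition_ge0 : forall i k l,
    k \in incident i -> l \in incident i -> k != l -> 0 <= transition s i k l;
  flow_oneway : forall k, flow s k (target k) * flow s k (source k) = 0;
  transition_oneway : forall i k l,
    k \in incident i -> l \in incident i -> k != l ->
    transition s i k l * transition s i l k = 0;
  value_switch : forall i k l,
    k \in incident i -> l \in incident i -> k != l ->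
    value s k i <= value s l i + switch_cost M i k l /\
    transition s i k l * (value s k i - value s l i - switch_cost M i k l) = 0;
  value_edge : forall k, let r := source k in let i := target k in
    let j := current s k in
    [/\ value s k r <= travel_cost M k i j + value s k i,
        value s k i <= travel_cost M k r j + value s k r,
        flow s k i * (value s k r - value s k i - travel_cost M k i j) = 0 &
        flow s k r * (value s k i - value s k r - travel_cost M k r j) = 0];
  conservation : forall i k, k \in incident i ->
    i \notin entrance M -> i \notin exits M ->
    \sum_(l in incident i | l != k) transition s i k l = flow s k i /\
    \sum_(l in incident i | l != k) transition s i l k
      = flow s k (opposite k i);
  entrance_flow : forall r k, k \in incident r -> r \in entrance M ->
    flow s k (opposite k r) = entry_current M r /\ flow s k r = 0;
  exit_flow : forall e l, l \in incident e -> e \in exits M ->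
    [/\ flow s l (opposite l e) = 0,
        value s l e <= 0 &
        0 < flow s l e -> value s l e = 0]
}.

(* Main.v *)
(* Monotonicity.  Write j, t for the edge and transition currents, u for the
   values, d for a difference between two solutions, and D for the drop of a
   value along an edge or a transition.  Summation by parts with Kirchhoff's
   laws and the boundary conditions gives
     sum_edges dj * D(du) + sum_transitions dt * D(du) <= 0,
   while complementarity makes each term nonnegative, so each vanishes.  On an
   edge, reversibility and evenness turn complementarity into |Du| <= c(j) and
   j * Du = |j| * c(j), hence
     dj * D(du) >= (|j| - |j'|) * (c(|j|) - c(|j'|)).
   As c is increasing, |j| = |j'|.  If j' = - j <> 0, the vanishing of the term
   also gives Du = Du', which contradicts c > 0. *)
Require Import Defs.
From mathcomp Require Import all_boot all_order all_algebra.
From mathcomp Require Import all_classical all_reals all_analysis.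
From mathcomp Require Import ring lra.
Set Implicit Arguments.
Unset Strict Implicit.
Unset Printing Implicit Defensive.
Import Order.TTheory GRing.Theory Num.Theory.
Local Open Scope ring_scope.

(** Double counting: the two endpoints of an edge are distinct, so each edge is met exactly
    twice. *)
Lemma sum_incident (R : realType) (G : network) (F : edge G -> vertex G -> R) :
  \sum_v \sum_(k in incident v) F k v =
  \sum_k (F k (source k) + F k (target k)).
Proof.
rewrite (exchange_big_dep predT) //=; apply: eq_bigr => k _.
rewrite (bigD1 (source k)) /=; last by rewrite inE /endpoint eqxx.
rewrite (bigD1 (target k)) /=; last first.
  by rewrite inE /endpoint eqxx orbT eq_sym source_neq_target.
rewrite big1 ?addr0 // => v; rewrite inE /endpoint -andbA.
by case: eqP => //= _; case: eqP.
Qed.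

(** Exchanging the names of [k] and [l] in the part with [U l] turns it into the inflow at [k]. *)
Lemma summation_by_parts_pairs (R : realType) (I : finType) (A : {set I})
    (d : I -> I -> R) (U : I -> R) :
  \sum_(k in A) \sum_(l in A | l != k) d k l * (U k - U l) =
  \sum_(k in A) U k * (\sum_(l in A | l != k) d k l
                       - \sum_(l in A | l != k) d l k).
Proof.
have swap : \sum_(k in A) \sum_(l in A | l != k) d k l * U l =
            \sum_(k in A) \sum_(l in A | l != k) d l k * U k.
  rewrite (exchange_big_dep (mem A)) /=; last by move=> k l _ /andP[].
  apply: eq_bigr => k kA; apply: eq_bigl => l.
  by rewrite kA /= eq_sym.
under eq_bigr => k _ do
  (under eq_bigr => l _ do rewrite mulrBr; rewrite sumrB).
rewrite sumrB swap -sumrB; apply: eq_bigr => k _.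
by rewrite -!mulr_suml -mulrBl mulrC.
Qed.

Section EdgeMonotonicity.
Variables (R : realType) (c : R -> R).
Hypothesis c_even : forall j, c (- j) = c j.
Hypothesis c_increasing : forall j1 j2, 0 <= j1 -> j1 < j2 -> c j1 < c j2.
Variables (j j' a a' : R).
Hypotheses (a_bound : `|a| <= c j) (a'_bound : `|a'| <= c j').
Hypotheses (ja : j * a = `|j| * c j) (ja' : j' * a' = `|j'| * c j').

Let c_norm x : c `|x| = c x.
Proof. by case: (ger0P x) => // _; rewrite c_even. Qed.

(** Here [a] and [a'] stand for value drops. In the expanded product [ja] and [ja'] give the
    diagonal terms exactly, and the bounds on [a] and [a'] control the cross terms. *)
Lemma edge_drop_lower_bound :
  (`|j| - `|j'|) * (c j - c j') <= (j - j') * (a - a').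
Proof.
have cross (x y z : R) : `|y| <= z -> x * y <= `|x| * z.
  move=> yz; apply: (le_trans (ler_norm _)).
  by rewrite normrM ler_wpM2l.
have h1 := cross j _ _ a'_bound; have h2 := cross j' _ _ a_bound.
have -> : (j - j') * (a - a') = j * a + j' * a' - j * a' - j' * a by ring.
by rewrite ja ja'; nra.
Qed.

(** Monotonicity is assumed only for nonnegative currents; evenness, through [c_norm], carries it to
    absolute values. *)
Lemma cost_monotone_norm : `|j| != `|j'| ->
  0 < (`|j| - `|j'|) * (c j - c j').
Proof.
rewrite -(c_norm j) -(c_norm j') neq_lt => /orP[] lt_jj'.
  have := c_increasing (normr_ge0 j) lt_jj'.
  by move=> h; rewrite nmulr_lgt0 ?subr_lt0.
have := c_increasing (normr_ge0 j') lt_jj'.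
by move=> h; rewrite mulr_gt0 ?subr_gt0.
Qed.

Lemma edge_drop_monotone : 0 <= (j - j') * (a - a').
Proof.
apply: le_trans _ edge_drop_lower_bound.
have [->|/cost_monotone_norm/ltW//] := eqVneq `|j| `|j'|.
by rewrite subrr mul0r.
Qed.

Lemma edge_drop_strict : 0 < c j -> (j - j') * (a - a') = 0 -> j = j'.
Proof.
move=> c_gt0 drop0.
have [/eqP|/cost_monotone_norm/lt_le_trans] := eqVneq `|j| `|j'|; last first.
  by move/(_ _ edge_drop_lower_bound); rewrite drop0 ltxx.
rewrite eqr_norm2 => /orP[/eqP//|/eqP jN].
have [j0|j_neq0] := eqVneq j 0; first by move: jN; lra.
have j'E : j' = - j by rewrite jN opprK.
(* With [j' = - j] and [a = a'], the identities [ja] and [ja'] force [|j| * c j] to equal its own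
   opposite, although it is positive. *)
move/eqP: drop0; rewrite mulf_eq0 !subr_eq0 => /orP[/eqP//|/eqP aa'].
move: ja'; rewrite j'E -aa' normrN c_even mulNr ja => h.
have : 0 < `|j| * c j by rewrite mulr_gt0 ?normr_gt0.
by lra.
Qed.

End EdgeMonotonicity.

(** Only the cross terms [- t * x'] and [- t' * x] survive, and both are nonnegative. *)
Lemma complementarity_monotone (R : realType) (t t' x x' : R) :
  0 <= t -> 0 <= t' -> x <= 0 -> x' <= 0 -> t * x = 0 -> t' * x' = 0 ->
  0 <= (t - t') * (x - x').
Proof. by nra. Qed.

Lemma norm_sub_oneway (R : realType) (x y : R) :
  0 <= x -> 0 <= y -> x * y = 0 -> `|x - y| = x + y.
Proof.
move=> x0 y0 /eqP; rewrite mulf_eq0 => /orP[] /eqP->.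
  by rewrite !add0r normrN ger0_norm.
by rewrite subr0 addr0 ger0_norm.
Qed.

Lemma incident_source (G : network) (k : edge G) : k \in incident (source k).
Proof. by rewrite inE /endpoint eqxx. Qed.

Lemma incident_target (G : network) (k : edge G) : k \in incident (target k).
Proof. by rewrite inE /endpoint eqxx orbT. Qed.

Lemma opposite_source (G : network) (k : edge G) :
  opposite k (source k) = target k.
Proof. by rewrite /opposite eqxx. Qed.

Lemma opposite_target (G : network) (k : edge G) :
  opposite k (target k) = source k.
Proof. by rewrite /opposite eq_sym (negPf (source_neq_target k)). Qed.

Section SolutionDrops.
Variables (R : realType) (G : network) (M : mfg_data R G).
Hypothesis cost_reversible : forall (k : edge G) (j : R),
  travel_cost M k (target k) j = travel_cost M k (source k) j.
Variable s : mfg_unknowns R G.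
Hypothesis sol_s : mfg_solution M s.

Let drop k := value s k (source k) - value s k (target k).

(** By reversibility the two inequalities of [value_edge] share one cost and form the two halves of
    an absolute value bound. *)
Lemma drop_le_cost k :
  `|drop k| <= travel_cost M k (target k) (current s k).
Proof.
have [h1 h2 _ _] := value_edge sol_s k.
by rewrite ler_norml /drop; rewrite -cost_reversible in h2; lra.
Qed.

(** Sum of the two complementarity identities of the edge; since the flow is one-way, the total flow
    is the absolute value of the current. *)
Lemma current_drop k : current s k * drop k =
  `|current s k| * travel_cost M k (target k) (current s k).
Proof.
have [_ _ h1 h2] := value_edge sol_s k; rewrite -cost_reversible in h2.
have f1 : 0 <= flow s k (target k).
  by apply: (flow_ge0 sol_s); rewrite /endpoint eqxx orbT.
have f2 : 0 <= flow s k (source k).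
  by apply: (flow_ge0 sol_s); rewrite /endpoint eqxx.
have -> : `|current s k| = flow s k (target k) + flow s k (source k).
  exact: norm_sub_oneway f1 f2 (flow_oneway sol_s k).
move: h1 h2; set c := travel_cost _ _ _ _ => h1 h2.
by rewrite /drop /current; lra.
Qed.

End SolutionDrops.

Section TwoSolutions.
Variables (R : realType) (G : network) (M : mfg_data R G).
Hypothesis model_M : mfg_model M.
Variables s s' : mfg_unknowns R G.
Hypotheses (sol_s : mfg_solution M s) (sol_s' : mfg_solution M s').

Let U k v := value s k v - value s' k v.
Let df k v := flow s k v - flow s' k v.
Let dt i k l := transition s i k l - transition s' i k l.

(** The switching cost does not depend on the solution, so it cancels in the difference of the
    slacks. *)
Lemma transition_monotone i k l :
  k \in incident i -> l \in incident i -> k != l ->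
  0 <= dt i k l * (U k i - U l i).
Proof.
move=> ki li kl.
have [h1 h2] := value_switch sol_s ki li kl.
have [h1' h2'] := value_switch sol_s' ki li kl.
have := complementarity_monotone (transition_ge0 sol_s ki li kl)
  (transition_ge0 sol_s' ki li kl) _ _ h2 h2'.
rewrite /dt /U => h; apply: (le_trans (h _ _)); [lra|lra|].
by rewrite le_eqVlt; apply/orP; left; apply/eqP; ring.
Qed.

Lemma incidence1_neighbours0 i k (F : edge G -> R) :
  #|incident i| = 1%N -> k \in incident i ->
  \sum_(l in incident i | l != k) F l = 0.
Proof.
move=> /eqP/cards1P[k0 ->]; rewrite inE => /eqP->.
by rewrite big1 // => l; rewrite inE => /andP[->].
Qed.

(** The bracket vanishes at inner vertices by Kirchhoff's laws, and at entrances because the flows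
    are prescribed and there are no transitions. At an exit [- U k i * df k i] remains, which
    complementarity makes nonpositive. *)
Lemma balance_le0 i k : k \in incident i ->
  U k i * (df k (opposite k i) - df k i
    + (\sum_(l in incident i | l != k) dt i k l
       - \sum_(l in incident i | l != k) dt i l k)) <= 0.
Proof.
move=> ki.
have [iN|iN] := boolP (i \in entrance M).
  have i1 := entrance_incidence model_M iN.
  rewrite !incidence1_neighbours0 // /df.
  have [-> ->] := entrance_flow sol_s ki iN.
  have [-> ->] := entrance_flow sol_s' ki iN.
  by rewrite !subrr addr0 mulr0.
have [iX|iX] := boolP (i \in exits M).
  have i1 := exit_incidence model_M iX.
  have ik : endpoint k i by move: ki; rewrite inE.
  rewrite !incidence1_neighbours0 // /df /U.
  have [-> u0 uf] := exit_flow sol_s ki iX.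
  have [-> u0' uf'] := exit_flow sol_s' ki iX.
  have slack f u : 0 <= f -> (0 < f -> u = 0) -> f * u = 0 :> R.
    by rewrite le0r => /orP[/eqP->|f0 /(_ f0)->]; rewrite ?mul0r ?mulr0.
  have f0 := flow_ge0 sol_s ik; have f0' := flow_ge0 sol_s' ik.
  have := complementarity_monotone f0 f0' u0 u0'
    (slack _ _ f0 uf) (slack _ _ f0' uf').
  by nra.
have [h1 h2] := conservation sol_s ki iN iX.
have [h1' h2'] := conservation sol_s' ki iN iX.
rewrite /dt !sumrB h1 h2 h1' h2' /df.
by rewrite le_eqVlt; apply/orP; left; apply/eqP; ring.
Qed.

Lemma sum_edge_drops_le0 :
  \sum_k (current s k - current s' k) * (U k (source k) - U k (target k)) <= 0.
Proof.
have edges : \sum_k (current s k - current s' k)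
      * (U k (source k) - U k (target k)) =
    \sum_i \sum_(k in incident i) U k i * (df k (opposite k i) - df k i).
  (* The bracket is the net current entering [k] from [i], so it has opposite signs at the two
     endpoints. *)
  rewrite (sum_incident (fun k i => U k i * (df k (opposite k i) - df k i))).
  apply: eq_bigr => k _; rewrite opposite_source opposite_target.
  by rewrite /current /df; ring.
have transitions : 0 <= \sum_i \sum_(k in incident i)
    \sum_(l in incident i | l != k) dt i k l * (U k i - U l i).
  apply: sumr_ge0 => i _; apply: sumr_ge0 => k ki.
  apply: sumr_ge0 => l /andP[li lk].
  by rewrite transition_monotone // eq_sym.
(* As the transition sum is nonnegative, it suffices to bound the edge and transition sums together
   by zero. *)
rewrite -(lerD2r (\sum_i \sum_(k in incident i)
    \sum_(l in incident i | l != k) dt i k l * (U k i - U l i))) add0r.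
apply: le_trans _ transitions.
rewrite edges -big_split /=; apply: sumr_le0 => i _.
rewrite (@summation_by_parts_pairs R _ _ (dt i) (U^~ i)) -big_split /=.
by apply: sumr_le0 => k ki; rewrite -mulrDr; exact: balance_le0.
Qed.

End TwoSolutions.

Theorem proposition5p7 (R : realType) (G : network) (M : mfg_data R G)
  (model_M : mfg_model M)
  (cost_reversible : forall (k : edge G) (j : R),
    travel_cost M k (target k) j = travel_cost M k (source k) j)
  (cost_even : forall (k : edge G) (v : vertex G) (j : R), endpoint k v ->
    travel_cost M k v (- j) = travel_cost M k v j)
  (cost_increasing : forall (k : edge G) (v : vertex G) (j1 j2 : R),
    endpoint k v -> 0 <= j1 -> j1 < j2 ->
    travel_cost M k v j1 < travel_cost M k v j2)
  (cost_positive : forall (k : edge G) (j : R),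
    0 < travel_cost M k (target k) j + travel_cost M k (source k) (- j))
  (s s' : mfg_unknowns R G)
  (sol_s : mfg_solution M s) (sol_s' : mfg_solution M s') :
  forall k : edge G, current s k = current s' k.
Proof.
have tgt k : endpoint k (target k) by rewrite /endpoint eqxx orbT.
pose c k := travel_cost M k (target k).
have c_even k j : c k (- j) = c k j by exact: cost_even.
have c_incr k j1 j2 : 0 <= j1 -> j1 < j2 -> c k j1 < c k j2.
  exact: cost_increasing.
(* Reversibility and evenness make the sum in [cost_positive] equal to [2 * c k j]. *)
have c_gt0 k j : 0 < c k j.
  have := cost_positive k j.
  by rewrite -cost_reversible -/(c k) c_even /c; lra.
pose drop (x : mfg_unknowns R G) k := value x k (source k) - value x k (target k).
pose term k := (current s k - current s' k) * (drop s k - drop s' k).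
have term_ge0 k : 0 <= term k.
  exact: (edge_drop_monotone (c_even k) (c_incr k)
    (drop_le_cost cost_reversible sol_s k)
    (drop_le_cost cost_reversible sol_s' k)
    (current_drop cost_reversible sol_s k)
    (current_drop cost_reversible sol_s' k)).
have sum0 : \sum_k term k = 0.
  apply/eqP; rewrite eq_le sumr_ge0 // andbT.
  apply: le_trans _ (sum_edge_drops_le0 model_M sol_s sol_s').
  by apply: ler_sum => k _; rewrite le_eqVlt /term /drop; apply/orP; left;
     apply/eqP; ring.
move=> k.
apply: (edge_drop_strict (c_even k) (c_incr k)
    (drop_le_cost cost_reversible sol_s k)
    (drop_le_cost cost_reversible sol_s' k)
    (current_drop cost_reversible sol_s k)
    (current_drop cost_reversible sol_s' k) (c_gt0 k _)).
(* Nonnegative terms with zero sum all vanish. *)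
by move/psumr_eq0P: sum0; apply.
Qed.
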